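(* Let $\{X_i : i\in I\}$ be a family of $T_0$ spaces. Then the following two conditions are equivalent: (1) The product space $\prod_{i\in I}X_i$ is $\omega$-well-filtered. (2) For each $i\in I$, $X_i$ is $\omega$-well-filtered.
   Context: A subset of a space is saturated if it equals the intersection of all open sets containing it. A family of sets is filtered if it is nonempty and for any two members there is a member contained in both. A $T_0$ space $X$ is $\omega$-well-filtered if for every countable filtered family $\{K_i : i<\omega\}$ of nonempty compact saturated subsets of $X$ and every open $U\subseteq X$, $\bigcap_{i<\omega}K_i\subseteq U$ implies $K_{i_0}\subseteq U$ for some $i_0<\omega$. The product space carries the product topology.
   Formalization: All the spaces X_i are assumed nonempty; otherwise an empty factor makes the product empty, hence vacuously ω-well-filtered, even when another factor (e.g. the naturals with the cofinite topology) is not ω-well-filtered. *)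

(* Defs.v *)
From mathcomp Require Import all_boot all_order all_algebra.
From mathcomp Require Import all_classical all_reals all_analysis.

Set Implicit Arguments.
Unset Strict Implicit.
Unset Printing Implicit Defensive.

Local Open Scope classical_set_scope.

Definition saturated (T : topologicalType) (A : set T) : Prop :=
  A = \bigcap_(U in [set U : set T | open U /\ A `<=` U]) U.

Definition filtered_family (T : Type) (F : set (set T)) : Prop :=
  F !=set0 /\
  forall A B, F A -> F B -> exists C, F C /\ C `<=` A /\ C `<=` B.

(* The members of a family indexed by [nat] may repeat, so finite families
   are covered as well. *)
Definition omega_well_filtered (T : topologicalType) : Prop :=
  kolmogorov_space T /\
  forall K : nat -> set T,
    filtered_family (range K) ->
    (forall i, [/\ K i !=set0, compact (K i) & saturated (K i)]) ->
    forall U : set T, open U ->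
      \bigcap_i K i `<=` U -> exists i0, K i0 `<=` U.

(* Main.v *)
Require Import Defs.
From mathcomp Require Import all_boot all_order all_algebra.
From mathcomp Require Import all_classical all_reals all_analysis.

(** Saturations of compact sets are compact, so an omega-well-filtered space [T]
    also controls images: if [L] is a filtered sequence of nonempty compact
    sets in some space [S], and [f : S -> T] is continuous, then an open set
    that contains the intersection of the saturations of the [f @` L n] contains
    some [f @` L n] ([omega_well_filtered_image]). Both directions rest on this
    fact.

    A factor is a retract of the product, because the other factors are
    nonempty. Applied to the section of a projection, the fact above transfers
    omega-well-filteredness from the product to the factor.

    For the converse, suppose that no [K n] is contained in the open set [U]. By
    Zorn's lemma and compactness, [U] lies in a maximal open set [W] that
    contains no [K n] ([rudin_maximal_open]; the complement of [W] is the
    minimal closed set of the topological Rudin lemma). Maximality says that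
    every open set not contained in [W] contains one of the compact sets
    [L n := K n `\` W], so that the complement of [W] is irreducible in a
    strong sense. In each factor, the fact above, applied to the projections of the
    [L n], gives a point [x i] that lies in all the saturations of these
    projections and in the closure of the projection of the complement of [W].
    Two consequences follow, and both can be checked one coordinate at a time,
    since convergence in a product is coordinatewise:
    - the filter generated by the [L n] converges to [x], because every open
      neighborhood of [x i] meets the projection of the complement of [W];
    - every neighborhood of a point of the complement of [W] contains [x],
      because every open set of a factor that meets that projection contains a
      projected [L n], hence its saturation, hence [x i].
    By the second, [x] belongs to every saturated set that meets the complement
    of [W], so to every [K n]. If the intersection of the [K n] were contained
    in [U], then [W] would be a neighborhood of [x], and by the first it would
    contain some [L n], which is nonempty and disjoint from [W]. *)

Local Open Scope classical_set_scope.

(** * Saturations *)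

Definition saturation {T : topologicalType} (A : set T) : set T :=
  \bigcap_(U in [set U : set T | open U /\ A `<=` U]) U.

Lemma sub_saturation {T : topologicalType} (A : set T) : A `<=` saturation A.
Proof. by move=> x Ax U [_]; apply. Qed.

Lemma saturation_sub_open {T : topologicalType} (A U : set T) :
  open U -> A `<=` U -> saturation A `<=` U.
Proof. by move=> oU AU x; apply. Qed.

Lemma saturationS {T : topologicalType} (A B : set T) :
  A `<=` B -> saturation A `<=` saturation B.
Proof.
by move=> AB x Ax U [oU BU]; apply: Ax; split=> //; apply: subset_trans BU.
Qed.

Lemma saturated_saturation {T : topologicalType} (A : set T) :
  saturated (saturation A).
Proof.
rewrite /saturated eqEsubset; split; first exact: sub_saturation.
by move=> x Ax U [oU AU]; apply: Ax; split=> //; exact: saturation_sub_open.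
Qed.

(** An open set that covers [A] covers its saturation, so that the interiors of
    the sets of an eventual cover of [A] eventually cover the saturation. *)
Lemma compact_saturation {T : topologicalType} (A : set T) :
  compact A -> compact (saturation A).
Proof.
rewrite !compact_near_coveringP => cA I F P FF covF.
have /(cA I F (fun i x => (P i)° x) FF) : forall x, A x ->
    \forall x' \near x & i \near F, (P i)° x'.
  move=> x /sub_saturation /covF[[/= N G] [Nx FG] NGP].
  exists (N°, G) => /=; first by split=> //; exact: nbhs_interior.
  move=> [y i] /= [Ny Gi]; apply: filterS Ny => z Nz.
  exact: (NGP (z, i)).
apply: filterS => i AP; apply: subset_trans (@interior_subset _ _).
by apply: saturation_sub_open => //; exact: open_interior.
Qed.

Lemma filtered_rangeP {T : Type} (K : nat -> set T) :
  filtered_family (range K) <->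
  forall m n, exists l, K l `<=` K m /\ K l `<=` K n.
Proof.
split=> [[_ KF] m n|KF].
  have [||_ [[l _ <-] KK]] := KF (K m) (K n); [by exists m|by exists n|].
  by exists l.
split; first by exists (K 0%N); exists 0%N.
move=> _ _ [m _ <-] [n _ <-]; have [l KK] := KF m n.
by exists (K l); split=> //; exists l.
Qed.

(** The saturations of the images are again a filtered sequence of nonempty
    compact saturated sets. The hypothesis bears on the saturations because the
    images need not be saturated, and their intersection may well be empty. *)
Lemma omega_well_filtered_image {S T : topologicalType} {f : S -> T}
    {L : nat -> set S} {V : set T} :
  omega_well_filtered T -> continuous f ->
  (forall m n, exists l, L l `<=` L m /\ L l `<=` L n) ->
  (forall n, L n !=set0) -> (forall n, compact (L n)) -> open V ->
  \bigcap_n saturation (f @` L n) `<=` V -> exists n, f @` L n `<=` V.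
Proof.
move=> [_ wfT] cf LF L0 cL oV LV.
have [||n LnV] := wfT (fun n => saturation (f @` L n)) _ _ V oV LV.
- apply/filtered_rangeP => m n; have [l [lm ln]] := LF m n.
  by exists l; split; apply: saturationS; exact: image_subset.
- move=> n; split.
  + have [x Lx] := L0 n; exists (f x); apply: sub_saturation.
    by exists x.
  + apply/compact_saturation/continuous_compact => //.
    exact: continuous_subspaceT.
  + exact: saturated_saturation.
- by exists n; exact: subset_trans (@sub_saturation _ _) LnV.
Qed.

(** * The topological Rudin lemma *)

(** A chain of open sets is directed, so a finite subcover reduces to a single
    member. *)
Lemma compact_chain_bigcup {T : topologicalType} {A : set T}
    {C : set (set T)} :
  compact A -> (forall V, C V -> open V) -> C !=set0 -> total_on C subset ->
  A `<=` \bigcup_(V in C) V -> exists2 V, C V & A `<=` V.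
Proof.
rewrite compact_near_coveringP => cA oC [V0 CV0] totC AC.
pose F : set_system (set T) :=
  filter_from C (fun V => [set W | C W /\ V `<=` W]).
(* [F] is the filter of the tails of the chain; compactness then turns pointwise
   eventual membership into uniform eventual membership. *)
have FF : Filter F.
  apply: filter_from_filter; first by exists V0.
  move=> V W CV CW; have [VW|WV] := totC _ _ CV CW.
    by exists W => // Z [CZ WZ]; split; split=> //; exact: subset_trans WZ.
  by exists V => // Z [CZ VZ]; split; split=> //; exact: subset_trans VZ.
have [|V CV VA] := cA _ F (fun V x => V x) FF.
  move=> x /AC[V CV Vx]; exists (V, [set W | C W /\ V `<=` W]) => /=.
    by split; [apply: open_nbhs_nbhs; split=> //; apply: oC|exists V].
  by move=> [y W] /= [Vy [_]]; apply.
by exists V => //; apply: (VA V); split.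
Qed.

(** The topological Rudin lemma, in terms of complements: the complement of [W]
    is a minimal closed set among those that avoid [U] and meet every [K i]. It
    is compactness of the [K i] that makes unions of chains admissible for
    Zorn's lemma. *)
Lemma rudin_maximal_open {T : topologicalType} {I : Type} {K : I -> set T}
    {U : set T} :
  (forall i, compact (K i)) -> open U -> (forall i, ~ K i `<=` U) ->
  exists W : set T, [/\ open W, U `<=` W, (forall i, ~ K i `<=` W) &
    forall V, open V -> ~ V `<=` W -> exists i, K i `<=` W `|` V].
Proof.
move=> cK oU KU.
(* Requiring [U `|` V], and not [V], to contain no [K i] makes the empty chain
   unproblematic. *)
pose P : set (set T) := [set V | open V /\ forall i, ~ K i `<=` U `|` V].
have [|W [[oW KW] maxW]] := @Zorn_bigcup T P.
  move=> C CP totC; split; first by apply: bigcup_open => V /CP[].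
  move=> i; have [->|/set0P[V0 CV0]] := eqVneq C set0.
    by rewrite bigcup_set0 setU0; exact: KU.
  move=> KC; pose C' := [set U `|` V | V in C].
  have [||||_ [V CV <-]] := @compact_chain_bigcup _ (K i) C' (cK i).
  - by move=> _ [V /CP[oV _] <-]; exact: openU.
  - by exists (U `|` V0); exists V0.
  - move=> _ _ [V CV <-] [Z CZ <-].
    by have [VZ|ZV] := totC _ _ CV CZ; [left|right]; exact: setUS.
  - move=> x /KC[Ux|[V CV Vx]]; first by exists (U `|` V0); [exists V0|left].
    by exists (U `|` V); [exists V|right].
  by have [_] := CP _ CV; exact.
exists (U `|` W); split=> //; first exact: openU.
move=> V oV VW; apply: contrapT => /forallNP KV.
apply: (maxW (W `|` V)); last first.
  by split=> [|i]; [exact: openU|rewrite setUA; exact: KV].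
split; first exact: subsetUl.
by move=> WVW; apply: VW => x Vx; right; apply: WVW; right.
Qed.

(** * Product spaces *)

(** The product topology is the coarsest one that makes the projections
    continuous, so coordinatewise convergence suffices. *)
Lemma cvg_prod_topology (I : Type) (X : I -> topologicalType)
    (F : set_system (prod_topology X)) (x : prod_topology X) :
  Filter F -> (forall i, (fun g : prod_topology X => g i) @ F --> x i) ->
  F --> x.
Proof.
move=> FF Fx; apply/cvg_sup => i A /=.
move=> [_ [[B oB <-] Bx] BA]; apply: filterS BA _.
by apply: (Fx i); apply: open_nbhs_nbhs.
Qed.

Lemma coord_continuous (I : Type) (X : I -> topologicalType) (i : I) :
  continuous (fun g : prod_topology X => g i).
Proof. exact: (@proj_continuous {classic I} X i). Qed.

Lemma kolmogorov_prod_topology (I : Type) (X : I -> topologicalType) :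
  (forall i, kolmogorov_space (X i)) -> kolmogorov_space (prod_topology X).
Proof.
move=> T0X x y /eqP xy.
have [i /eqP /T0X[A]] : exists i, x i <> y i.
  by apply/existsNP => xyE; apply: xy; exact: functional_extensionality_dep.
rewrite !inE => -[[Ax nAy]|[Ay nAx]].
  exists ((fun g : prod_topology X => g i) @^-1` A); left; rewrite !inE.
  by split=> //; exact: coord_continuous.
exists ((fun g : prod_topology X => g i) @^-1` A); right; rewrite !inE.
by split=> //; exact: coord_continuous.
Qed.

(** The [i]-th factor is embedded in the product by freezing the other
    coordinates at points that exist because the factors are nonempty. This
    section of the projection is continuous, and the projection maps the
    saturation of the image of [K n] back into [K n]. *)
Lemma omega_well_filtered_factor (I : Type) (X : I -> topologicalType) (i : I) :
  (forall j, [set: X j] !=set0) -> kolmogorov_space (X i) ->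
  omega_well_filtered (prod_topology X) -> omega_well_filtered (X i).
Proof.
move=> X0 T0 wfX; split=> // K /filtered_rangeP KF KP U oU KU.
pose x0 : prod_topology X := fun j => projT1 (cid (X0 j)).
pose s : X i -> prod_topology X := @dfwith {classic I} X x0 i.
pose p := fun g : prod_topology X => g i.
have ps y : p (s y) = y by exact: (@dfwith_in {classic I}).
have cp : continuous p by exact: coord_continuous.
have [|||||n KnU] := @omega_well_filtered_image _ _ s K (p @^-1` U) wfX _ KF.
- exact: (@dfwith_continuous {classic I}).
- by move=> n; have [] := KP n.
- by move=> n; have [] := KP n.
- by apply: open_comp => // g _; exact: cp.
- move=> g gK; apply: KU => n _; have [_ _ ->] := KP n.
  move=> V [oV KV]; apply: (gK n Logic.I (p @^-1` V)); split.
    by apply: open_comp => // h _; exact: cp.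
  by move=> _ [y /KV Vy <-]; rewrite /preimage /= ps.
by exists n => y Ky; rewrite -(ps y); apply: KnU; exists y.
Qed.

Lemma omega_well_filtered_prod (I : Type) (X : I -> topologicalType) :
  (forall i, omega_well_filtered (X i)) ->
  omega_well_filtered (prod_topology X).
Proof.
move=> wfX; split.
  by apply: kolmogorov_prod_topology => i; have [] := wfX i.
move=> K /filtered_rangeP KF KP U oU KU; apply: contrapT => /forallNP nKU.
have cK n : compact (K n) by have [] := KP n.
have [W [oW UW KW maxW]] := rudin_maximal_open cK oU nKU.
pose p i := fun g : prod_topology X => g i.
have op i V : open V -> open (p i @^-1` V).
  by move=> oV; apply: open_comp => // g _; exact: coord_continuous.
pose L n := K n `&` ~` W.
have L0 n : L n !=set0.
  apply: contrapT => Ln; apply: (KW n) => x Kx; apply: contrapT => Wx.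
  by apply: Ln; exists x.
have LF m n : exists l, L l `<=` L m /\ L l `<=` L n.
  by have [l [lm ln]] := KF m n; exists l; split; exact: setSI.
have cL n : compact (L n) by apply: compact_closedI => //; exact: open_closedC.
(* The strong irreducibility of the complement of [W] from which both
   properties of the point [x] below are obtained. *)
have LV V : open V -> ~ V `<=` W -> exists n, L n `<=` V.
  move=> oV /(maxW _ oV)[n KV]; exists n => x [/KV[]//].
(* Otherwise the complement of the closure would contain the intersection of
   the saturations, hence a whole projected [L n]. *)
have xP i : exists y, (forall n, saturation (p i @` L n) y) /\
    closure (p i @` ~` W) y.
  apply: contrapT => /forallNP noy.
  have [|||n Ln] := @omega_well_filtered_image _ _ (p i) L
      (~` closure (p i @` ~` W)) (wfX i) _ LF L0 cL.
  - exact: coord_continuous.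
  - exact/closed_openC/closed_closure.
  - by move=> y Ly cly; apply: (noy y); split=> // n; exact: Ly.
  have [c [Kc Wc]] := L0 n; apply: (Ln (p i c)); first by exists c.
  by apply: subset_closure; exists c.
pose x : prod_topology X := fun i => projT1 (cid (xP i)).
have satx i n : saturation (p i @` L n) (x i).
  by rewrite /x; case: cid => y [].
have clx i : closure (p i @` ~` W) (x i) by rewrite /x; case: cid => y [].
pose F := filter_from [set: nat] L.
have FF : Filter F.
  apply: filter_fromT_filter; first by exists 0%N.
  by move=> m n; have [l [lm ln]] := LF m n; exists l => y Ly; split; auto.
have Fx : F --> x.
  apply: cvg_prod_topology => i A; rewrite nbhsE => -[V [oV Vx] VA].
  have [_ [[c Wc <-] Vc]] := clx i _ (open_nbhs_nbhs (conj oV Vx)).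
  have [|n LnV] := LV _ (op i _ oV); first by move/(_ _ Vc).
  by exists n => // y /LnV; exact: VA.
(* Every neighborhood of [c] contains [x]: this is the specialization order,
   stated as convergence of a principal filter so as to be checked on
   coordinates. *)
have cvgx c : ~ W c -> globally [set x] --> c.
  move=> Wc; apply: cvg_prod_topology => i A; rewrite nbhsE => -[V [oV Vc] VA].
  have [|n LnV] := LV _ (op i _ oV); first by move/(_ _ Vc).
  move=> _ ->; apply: VA.
  apply: (saturation_sub_open _ _ oV _ _ (satx i n)) => //.
  by move=> _ [y /LnV Vy <-].
have Kx n : K n x.
  have [_ _ ->] := KP n; move=> V [oV KV]; have [c [/KV Vc Wc]] := L0 n.
  by apply: (cvgx c Wc V); [exact: open_nbhs_nbhs|].
have [n _ LnW] : F W by apply/Fx/open_nbhs_nbhs; split=> //; apply/UW/KU => n _.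
by have [c /[dup] /LnW Wc []] := L0 n.
Qed.

Theorem theorem6p16 (I : Type) (X : I -> topologicalType)
    (X_nonempty : forall i, [set: X i] !=set0)
    (X_T0 : forall i, kolmogorov_space (X i)) :
  omega_well_filtered (prod_topology X) <->
  (forall i, omega_well_filtered (X i)).
Proof.
split; last exact: omega_well_filtered_prod.
by move=> wfX i; exact: omega_well_filtered_factor.
Qed.
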